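(* Let $\Gamma_1$ be a finite graph and let $\Gamma_2$ be an arbitrary (finite or countably infinite) graph, with no common vertices. Let $v_1\in\mathcal V(\Gamma_1)$, $v_2\in\mathcal V(\Gamma_2)$, and let $\Gamma=\Gamma_1+\Gamma_2$ be the coupling of $\Gamma_1$ and $\Gamma_2$ by means of the bridge $\{v_1,v_2\}$. Let $\lambda\in\mathbb C$ be a regular point of $\Gamma_2$, i.e., $\lambda\in\rho(A(\Gamma_2))$. Then $\lambda$ belongs to the spectrum of $A(\Gamma)$ if and only if $$P(\lambda,\Gamma_1)-G(\lambda,\Gamma_2)\,P(\lambda,\Gamma_1\backslash v_1)=0.$$
   Context: Graphs are simple, connected, undirected, and finite or countably infinite, with vertex set $\mathcal V(\cdot)$ and edge set $\mathcal E(\cdot)$; they are locally finite (every vertex has finite degree). (The connectedness convention applies to $\Gamma_1$, $\Gamma_2$ and hence $\Gamma$; the subgraph $\Gamma_1\backslash v_1$ need not be connected.) Adjacency operator: for a graph $\Gamma$, $A(\Gamma)$ is the operator on $\ell^2(\mathcal V(\Gamma))$ (which is $\mathbb C^n$ if $\Gamma$ has $n$ vertices) acting on the standard basis $\{e_v\}_{v\in\mathcal V(\Gamma)}$ by $A(\Gamma)e_v=\sum_{u\sim v}e_u$, where $u\sim v$ means $\{u,v\}\in\mathcal E(\Gamma)$. It is defined on finite linear combinations of basis vectors, where it is symmetric, and is then replaced by its closure. If the vertex degrees are uniformly bounded, $A(\Gamma)$ is a bounded self-adjoint operator on the whole space. For a finite graph, $A(\Gamma)$ is the usual $0$-$1$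 adjacency matrix. Resolvent set and spectrum: $\rho(T)$ is the set of $\lambda\in\mathbb C$ such that $\lambda I-T$ is boundedly invertible, and the spectrum is $\sigma(T)=\mathbb C\setminus\rho(T)$. Coupling: $\Gamma=\Gamma_1+\Gamma_2$ by means of the bridge $\{v_1,v_2\}$ is the graph with $\mathcal V(\Gamma)=\mathcal V(\Gamma_1)\cup\mathcal V(\Gamma_2)$ and $\mathcal E(\Gamma)=\mathcal E(\Gamma_1)\cup\mathcal E(\Gamma_2)\cup\{\{v_1,v_2\}\}$, i.e., the two graphs are joined by one new edge between $v_1$ and $v_2$. Characteristic polynomial: for a finite graph $F$, $P(\lambda,F)=\det(\lambda I-A(F))$, with $P(\lambda,\emptyset)=1$ for the empty graph. For $v\in\mathcal V(F)$, $F\backslash v$ is the subgraph of $F$ induced by $\mathcal V(F)\setminus\{v\}$. Green's function: for $\lambda\in\rho(A(\Gamma_2))$, $G(\lambda,\Gamma_2)=\langle(\lambda I-A(\Gamma_2))^{-1}e_{v_2},e_{v_2}\rangle$, i.e., the diagonal entry of the resolvent matrix at the vertex $v_2$ (the vertex of $\Gamma_2$ to which the bridge is attached, listed first in the enumeration of $\mathcal V(\Gamma_2)$). *)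

(* Defs.v *)
From HB Require Import structures.
From mathcomp Require Import all_boot all_order all_algebra finmap.
From mathcomp Require Import all_classical all_reals all_analysis.
From mathcomp Require Import complex ring.
From mathcomp Require analysis.showcase.summability.

Set Implicit Arguments.
Unset Strict Implicit.
Unset Printing Implicit Defensive.
Import Order.TTheory GRing.Theory Num.Theory.
Import numFieldNormedType.Exports.
Import ComplexField.Normc.

Local Open Scope ring_scope.
Local Open Scope complex_scope.
Local Open Scope classical_set_scope.

(* ell^2(V) is the submodule of square-summable families in V -> R[i]; its norm
   takes values in R[i] because a normedModType K has a K-valued norm. *)
Section SquareSummable.
Context (R : realType) (V : choiceType).
Implicit Types f g : V -> R[i].

Definition sqnorm f : \bar R := \esum_(v in setT) (normc (f v) ^+ 2)%:E.

Definition square_summable : {pred V -> R[i]} := fun f => (sqnorm f < +oo)%E.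

Lemma square_summableE f : (f \in square_summable) = (sqnorm f < +oo)%E.
Proof. by []. Qed.

Lemma sqnorm_ge0 f : (0 <= sqnorm f)%E.
Proof. by apply: esum_ge0 => v _; rewrite lee_fin sqr_ge0. Qed.

Lemma sqnorm_fin f : f \in square_summable -> sqnorm f \is a fin_num.
Proof. by move=> fS; rewrite ge0_fin_numE ?sqnorm_ge0. Qed.

Let esumZ (c : R) (a : V -> R) : 0 <= c -> (forall v, 0 <= a v) ->
  \esum_(v in setT) (c * a v)%:E = (c%:E * \esum_(v in setT) (a v)%:E)%E.
Proof.
move=> c0 a0; rewrite /esum -ereal_supZl//; last first.
  by apply/set0P; exists 0%E, set0; [exact: fsets_set0|rewrite fsbig_set0].
congr ereal_sup; rewrite image_comp; apply: eq_imagel => A [Afin _] /=.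
by rewrite ge0_mule_fsumr// => v; rewrite lee_fin.
Qed.

Lemma sqnormZ (c : R[i]) f : sqnorm (c *: f) = ((normc c ^+ 2)%:E * sqnorm f)%E.
Proof.
rewrite -esumZ ?sqr_ge0//; last by move=> v; exact: sqr_ge0.
by apply: eq_esum => v _; rewrite -exprMn -normcM.
Qed.

Let normc_ge0 (z : R[i]) : 0 <= normc z.
Proof. by case: z => a b; exact: sqrtr_ge0. Qed.

(* Young's inequality with a free parameter, optimized in [l2normD] *)
Let sqnormD_le (t : R) f g : 0 < t ->
  (sqnorm (f + g)%R <= (1 + t)%:E * sqnorm f + (1 + t^-1)%:E * sqnorm g)%E.
Proof.
move=> t0.
have t1 : 0 <= 1 + t by rewrite addr_ge0// ltW.
have ti1 : 0 <= 1 + t^-1 by rewrite addr_ge0// invr_ge0 ltW.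
rewrite -!esumZ//; try by move=> v; exact: sqr_ge0.
rewrite -esumD; last 2 first.
- by move=> v _; rewrite lee_fin mulr_ge0 ?sqr_ge0.
- by move=> v _; rewrite lee_fin mulr_ge0 ?sqr_ge0.
rewrite /sqnorm; apply: le_esum => v _; rewrite -EFinD lee_fin.
apply: (@le_trans _ _ ((normc (f v) + normc (g v)) ^+ 2)).
  rewrite ler_sqr ?nnegrE ?addr_ge0//.
  by apply: le_normcD.
have -> : (1 + t) * normc (f v) ^+ 2 + (1 + t^-1) * normc (g v) ^+ 2 =
  (normc (f v) + normc (g v)) ^+ 2 + t * (normc (f v) - t^-1 * normc (g v)) ^+ 2.
  by field; rewrite gt_eqF.
by rewrite lerDl mulr_ge0 ?sqr_ge0// ltW.
Qed.

Lemma square_summable_submod : submod_closed square_summable.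
Proof.
split=> [|c f g fS gS].
  rewrite square_summableE /sqnorm esum1// => v _.
  by rewrite normc0 expr0n.
rewrite square_summableE (le_lt_trans (sqnormD_le _ _ ltr01))//.
rewrite sqnormZ -ge0_fin_numE.
  by rewrite fin_numD !fin_numM ?sqnorm_fin.
by rewrite adde_ge0// !mule_ge0 ?sqnorm_ge0// lee_fin ?sqr_ge0// addr_ge0.
Qed.
HB.instance Definition _ :=
  GRing.isSubmodClosed.Build R[i] (V -> R[i]) square_summable
    square_summable_submod.

Definition l2norm f : R := Num.sqrt (fine (sqnorm f)).

Lemma l2normZ (c : R[i]) f :
  f \in square_summable -> l2norm (c *: f) = normc c * l2norm f.
Proof.
move=> fS; rewrite /l2norm sqnormZ fineM ?sqnorm_fin//=.
by rewrite sqrtrM ?sqr_ge0// sqrtr_sqr ger0_norm.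
Qed.

Lemma l2norm0_eq0 f : f \in square_summable -> l2norm f = 0 -> f = 0.
Proof.
move=> fS /eqP; rewrite sqrtr_eq0 => f0.
have {}f0 : sqnorm f = 0%E.
  apply/eqP; rewrite eq_le sqnorm_ge0 andbT -[leLHS]fineK ?sqnorm_fin//.
apply/funext => v; apply: eq0_normc; apply/eqP; rewrite -sqrf_eq0 eq_le sqr_ge0.
rewrite andbT -lee_fin -[leRHS]f0 /sqnorm; apply: esum_ge.
exists [set v]; first by split; [exact: finite_set1|].
by rewrite fsbig_set1.
Qed.

Lemma l2normD f g : f \in square_summable -> g \in square_summable ->
  l2norm (f + g) <= l2norm f + l2norm g.
Proof.
move=> fS gS; have fgS := rpredD fS gS.
have [f0|f0] := eqVneq (l2norm f) 0.
  by rewrite f0 (l2norm0_eq0 fS f0) !add0r.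
have [g0|g0] := eqVneq (l2norm g) 0.
  by rewrite g0 (l2norm0_eq0 gS g0) !addr0.
have {}f0 : 0 < l2norm f by rewrite lt_neqAle eq_sym f0 sqrtr_ge0.
have {}g0 : 0 < l2norm g by rewrite lt_neqAle eq_sym g0 sqrtr_ge0.
have sqE h : h \in square_summable -> sqnorm h = (l2norm h ^+ 2)%:E.
  by move=> hS; rewrite sqr_sqrtr ?fine_ge0 ?sqnorm_ge0// fineK ?sqnorm_fin.
rewrite -ler_sqr ?nnegrE ?addr_ge0 ?sqrtr_ge0// -lee_fin -sqE//.
apply: le_trans (sqnormD_le _ _ (divr_gt0 g0 f0)) _.
rewrite !sqE// -!EFinM -EFinD lee_fin le_eqVlt; apply/orP; left; apply/eqP.
by field; rewrite !gt_eqF.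
Qed.

Lemma square_summable_finite f :
  finite_set [set v | f v != 0] -> f \in square_summable.
Proof.
move=> ffin; rewrite square_summableE /sqnorm.
rewrite (_ : esum _ _ = \esum_(v in [set v | f v != 0]) (normc (f v) ^+ 2)%:E).
  rewrite esum_fset//; last by move=> v _; rewrite lee_fin sqr_ge0.
  by rewrite fsumEFin// ltry.
rewrite [RHS]esum_mkcond; apply: eq_esum => v _.
case: ifPn => //; rewrite notin_setE /= => /negP; rewrite negbK => /eqP ->.
by rewrite normc0 expr0n.
Qed.

End SquareSummable.

Section Ell2.
Context (R : realType) (V : choiceType).

Record ell2 := Ell2 {
  ell2_fun :> V -> R[i];
  ell2_fun_summable : ell2_fun \in @square_summable R V }.

HB.instance Definition _ := [isSub for ell2_fun].
HB.instance Definition _ := [Choice of ell2 by <:].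
HB.instance Definition _ := [SubChoice_isSubLmodule of ell2 by <:].

Let nrm (x : ell2) : R[i] := (l2norm x)%:C.

Let nrmD (x y : ell2) : nrm (x + y) <= nrm x + nrm y.
Proof. by rewrite -rmorphD lecR l2normD ?ell2_fun_summable. Qed.

Let nrmZ (c : R[i]) (x : ell2) : nrm (c *: x) = `|c| * nrm x.
Proof. by rewrite /nrm l2normZ ?ell2_fun_summable// rmorphM. Qed.

Let nrm0_eq0 (x : ell2) : nrm x = 0 -> x = 0.
Proof.
by case=> x0; apply: val_inj; exact: (l2norm0_eq0 (ell2_fun_summable x) x0).
Qed.

HB.instance Definition _ := Lmodule_isNormed.Build R[i] ell2 nrmD nrmZ nrm0_eq0.

Lemma ell2_normE (x : ell2) : `|x| = (l2norm x)%:C.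
Proof. by []. Qed.

(* [summability.sum] is the unconditional sum: the limit of the sums over the
   finite subsets of V, directed by inclusion. *)
Definition ell2_dot (x y : ell2) : R[i] :=
  @summability.sum V R[i] R[i]^o (fun v => x v * (y v)^*).

Lemma ell2_basis_subproof (v : V) :
  (fun u => (u == v)%:R) \in @square_summable R V.
Proof.
apply: square_summable_finite; apply: sub_finite_set (finite_set1 v) => u /=.
by have [//|_] := eqVneq u v; rewrite eqxx.
Qed.

Definition ell2_basis (v : V) : ell2 := Ell2 (ell2_basis_subproof v).

Lemma ell2_dot_basis (x : ell2) (v : V) : ell2_dot x (ell2_basis v) = x v.
Proof.
have ? := @summability.totally_filter V.
rewrite /ell2_dot /summability.sum; apply: (@cvg_lim R[i]^o); first exact: norm_hausdorff.
apply: cvg_near_cst; exists [fset v]%fset => //= A; rewrite /= fsub1set => vA.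
rewrite /summability.partial_sum (bigD1 [` vA]%fset)//= big1 => [|u uv].
  by rewrite eqxx addr0 rmorph1 mulr1.
have /negPf-> : val u != v by apply: contra uv => /eqP uv; exact/eqP/val_inj.
by rewrite rmorph0 mulr0.
Qed.

End Ell2.

Section Spectrum.
Context (K : numFieldType) (E : normedModType K).

(* A possibly unbounded, partially defined operator in E is represented by its
   graph, a subset of E * E. *)
Implicit Types T : set (E * E).

Definition boundedly_invertible T :=
  exists B : {linear E -> E},
    [/\ exists M : K, forall z, `|B z| <= M * `|z|,
        forall z, T (B z, z) &
        forall x z, T (x, z) -> B z = x].

Definition shift_operator (l : K) T : set (E * E) :=
  [set (p.1, l *: p.1 - p.2) | p in T].

Definition resolvent_set T : set K :=
  [set l | boundedly_invertible (shift_operator l T)].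

Definition spectrum T : set K := ~` resolvent_set T.

(* (l I - T)^-1 z when l is in the resolvent set, where the preimage of z is
   unique; a dummy value otherwise. *)
Definition resolvent T (l : K) (z : E) : E :=
  xget 0 [set x | shift_operator l T (x, z)].

End Spectrum.

Record sgraph (V : countType) := SGraph {
  adjacent :> rel V;
  adjacent_sym : symmetric adjacent;
  adjacent_irr : irreflexive adjacent;
  locally_finite : forall v, finite_set [set u | adjacent v u] }.

Definition connected_graph (V : countType) (G : sgraph V) :=
  forall u v, exists2 p, path G u p & last u p = v.

Section Coupling.
Context (V1 V2 : countType) (G1 : sgraph V1) (G2 : sgraph V2) (v1 : V1) (v2 : V2).

Definition coupling_rel (x y : V1 + V2) : bool :=
  match x, y with
  | inl u, inl w => G1 u w
  | inr u, inr w => G2 u w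
  | inl u, inr w => (u == v1) && (w == v2)
  | inr w, inl u => (u == v1) && (w == v2)
  end.

Lemma coupling_sym : symmetric coupling_rel.
Proof. by move=> [u|u] [w|w] //=; rewrite adjacent_sym. Qed.

Lemma coupling_irr : irreflexive coupling_rel.
Proof. by move=> [u|u] /=; rewrite adjacent_irr. Qed.

Lemma coupling_locally_finite x : finite_set [set y | coupling_rel x y].
Proof.
case: x => [u|u].
- apply: (@sub_finite_set _ _ (inl @` [set w | G1 u w] `|` [set inr v2])).
    by move=> [w|w] /= => [uw|/andP[_ /eqP->]]; [left; exists w|right].
  by rewrite finite_setU; split; [exact/finite_image/locally_finite|].
- apply: (@sub_finite_set _ _ (inr @` [set w | G2 u w] `|` [set inl v1])).
    by move=> [w|w] /= => [/andP[/eqP-> _]|uw]; [right|left; exists w].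
  by rewrite finite_setU; split; [exact/finite_image/locally_finite|].
Qed.

Definition coupling : sgraph (V1 + V2)%type :=
  SGraph coupling_sym coupling_irr coupling_locally_finite.

End Coupling.

Section DeleteVertex.
Context (V : finType) (G : sgraph V) (v : V).

Definition delete_rel : rel {u : V | u != v} := fun u w => G (val u) (val w).

Lemma delete_sym : symmetric delete_rel.
Proof. by move=> u w; exact: adjacent_sym. Qed.

Lemma delete_irr : irreflexive delete_rel.
Proof. by move=> u; exact: adjacent_irr. Qed.

Lemma delete_locally_finite u : finite_set [set w | delete_rel u w].
Proof. exact: finite_finset. Qed.

Definition delete_vertex : sgraph {u : V | u != v} :=
  SGraph delete_sym delete_irr delete_locally_finite.

End DeleteVertex.

Section AdjacencyOperator.
Context (R : realType) (V : countType) (G : sgraph V).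

Definition adjacency_basis (v : V) : ell2 R V :=
  \sum_(u \in [set u | G v u]) ell2_basis R u.

(* Linear extension of e_v |-> [adjacency_basis v] to the finite linear
   combinations of basis vectors; [\sum_(v \in setT)] ranges over the v for
   which the summand is nonzero, a finite set since x has finite support. *)
Definition finite_adjacency : set (ell2 R V * ell2 R V) :=
  [set (x, \sum_(v \in setT) x v *: adjacency_basis v)
     | x in [set x : ell2 R V | finite_set [set v | x v != 0]]].

Lemma finite_adjacency_basis v :
  finite_adjacency (ell2_basis R v, adjacency_basis v).
Proof.
exists (ell2_basis R v) => /=.
  apply: sub_finite_set (finite_set1 v) => u /=.
  by have [//|_] := eqVneq u v; rewrite eqxx.
congr pair; rewrite -(@fsbig_widen _ _ _ _ [set v])//.
  by rewrite fsbig_set1 /= eqxx scale1r.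
by move=> u [_ /= /eqP/negPf->]; rewrite scale0r.
Qed.

(* The closure of the operator is the one whose graph is the closure of the
   graph, in the product topology of ell^2(V) * ell^2(V). *)
Definition adjacency : set (ell2 R V * ell2 R V) := closure finite_adjacency.

Definition green (l : R[i]) (v : V) : R[i] :=
  ell2_dot (resolvent adjacency l (ell2_basis R v)) (ell2_basis R v).

End AdjacencyOperator.
Arguments adjacency_basis R {V} G v.
Arguments finite_adjacency R {V} G.
Arguments adjacency R {V} G.

Section CharacteristicPolynomial.
Context (R : realType) (V : finType) (G : sgraph V).

(* The entries are indexed by an enumeration of V, on which [characteristic]
   does not depend; for empty V the matrix is 0 x 0, with determinant 1. *)
Definition adjacency_mx : 'M[R[i]]_#|V| :=
  \matrix_(i, j) (G (enum_val i) (enum_val j))%:R.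

Definition characteristic (l : R[i]) : R[i] := \det (l%:M - adjacency_mx).

End CharacteristicPolynomial.
Arguments adjacency_mx R {V} G.

(* Main.v *)
From HB Require Import structures.
Require Import Defs.
From mathcomp Require Import all_boot all_order all_algebra.
From mathcomp Require Import finmap perm.
From mathcomp Require Import all_classical all_reals all_analysis.
From mathcomp Require Import complex ring.
Import Order.TTheory GRing.Theory Num.Theory.
Import numFieldNormedType.Exports.
Import ComplexField.Normc.

(* Write x in ell^2(V1 + V2) as (x1, x2), let A1, A2 be the adjacency operators
   and B = (l - A2)^-1.  The equation (l - A) x = y for the coupling amounts to
     x2 = B y2 + x1(v1) B e_{v2},
     (l - A1 - G(l) E) x1 = y1 + (B y2)(v2) e_{v1},
   where E is the matrix unit at (v1, v1).  Hence l is regular for A if and only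
   if the finite matrix l - A1 - G(l) E is invertible, and expanding along the
   row of v1 its determinant is P(l, G1) - G(l) P(l, G1 \ v1). *)

Set Implicit Arguments.
Unset Strict Implicit.
Unset Printing Implicit Defensive.

Local Open Scope ring_scope.
Local Open Scope complex_scope.
Local Open Scope classical_set_scope.

(** * Closures and continuity *)

(** Adjacency operators are closures, so this transfers to them what can be checked on finitely
    supported vectors. *)
Lemma closure_preimage (T U : topologicalType) (f : T -> U) (A : set T) (B : set U) :
  continuous f -> closed B -> A `<=` f @^-1` B -> closure A `<=` f @^-1` B.
Proof.
move=> /continuousP cf cB AB.
have cP : closed (f @^-1` B).
  by rewrite -openC preimage_setC; apply: cf; rewrite openC.
by rewrite [X in _ `<=` X](closure_id _).1//; exact: closure_subset.
Qed.

Lemma bound_linear_continuous (K : numFieldType) (E F : normedModType K)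
    (f : {linear E -> F}) (M : K) :
  0 <= M -> (forall x, `|f x| <= M * `|x|) -> continuous f.
Proof.
move=> M0 fM; apply: bounded_linear_continuous; apply/linear_boundedP.
near=> r => y; apply: le_trans (fM y) _; apply: ler_wpM2r => //.
by near: r; apply: nbhs_pinfty_ge; exact: ger0_real.
Unshelve. all: by end_near. Qed.

Lemma continuous_pair (T U V : topologicalType) (f : T -> U) (g : T -> V) :
  continuous f -> continuous g -> continuous (fun x => (f x, g x)).
Proof. by move=> cf cg x; apply: cvg_pair; [exact: cf|exact: cg]. Qed.

Lemma continuous_compose (T U V : topologicalType) (f : T -> U) (g : U -> V) :
  continuous f -> continuous g -> continuous (fun x => g (f x)).
Proof. by move=> cf cg x; apply: continuous_comp; [exact: cf|exact: cg]. Qed.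

Lemma continuous_fst (T U : topologicalType) : continuous (@fst T U).
Proof. by move=> p; exact: cvg_fst. Qed.

Lemma continuous_snd (T U : topologicalType) : continuous (@snd T U).
Proof. by move=> p; exact: cvg_snd. Qed.

Section ContinuousCombinations.
Context (K : numFieldType) (E : normedModType K) (T : topologicalType).
Implicit Types f g : T -> E.

Lemma continuous_addf f g :
  continuous f -> continuous g -> continuous (fun x => f x + g x).
Proof. by move=> cf cg x; apply: cvgD; [exact: cf|exact: cg]. Qed.

Lemma continuous_subf f g :
  continuous f -> continuous g -> continuous (fun x => f x - g x).
Proof. by move=> cf cg x; apply: cvgB; [exact: cf|exact: cg]. Qed.

Lemma continuous_scalef (s : T -> K^o) f :
  continuous s -> continuous f -> continuous (fun x => s x *: f x).
Proof. by move=> cs cf x; apply: cvgZ; [exact: cs|exact: cf]. Qed.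

Lemma continuous_sumf (I : Type) (r : seq I) (F : I -> T -> E) :
  (forall i, continuous (F i)) -> continuous (fun x => \sum_(i <- r) F i x).
Proof. by move=> cF; apply: continuous_big => //; exact: add_continuous. Qed.

End ContinuousCombinations.

(** * Coordinates, restriction and extension by zero in ell^2 *)

Section Ell2Theory.
Context (R : realType).

Lemma ell2P (V : choiceType) (x y : ell2 R V) : (forall v, x v = y v) -> x = y.
Proof. by move=> xy; apply: val_inj; apply/funext. Qed.

Lemma ell2_sumE (V I : choiceType) (A : set I) (F : I -> ell2 R V) v :
  finite_set A -> (\sum_(i \in A) F i) v = \sum_(i \in A) F i v.
Proof.
move=> Afin; rewrite !fsbig_finite//=.
by elim/big_ind2: _ => // [x a y b <- <-].
Qed.

Lemma ell2_bigsumE (V : choiceType) (I : Type) (r : seq I) (P : pred I)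
    (F : I -> ell2 R V) v :
  (\sum_(i <- r | P i) F i) v = \sum_(i <- r | P i) F i v.
Proof. by elim/big_ind2: _ => // [x a y b <- <-]. Qed.

Lemma sqnorm_ge (V : choiceType) (f : V -> R[i]) v :
  ((normc (f v) ^+ 2)%:E <= sqnorm f)%E.
Proof.
apply: esum_ge; exists [set v]; first by split; [exact: finite_set1|].
by rewrite fsbig_set1.
Qed.

Lemma ell2_norm_coord (V : choiceType) (x : ell2 R V) v : `|x v| <= `|x|.
Proof.
rewrite ell2_normE normc_def lecR /l2norm.
rewrite ler_sqrt ?fine_ge0 ?sqnorm_ge0//.
rewrite -lee_fin fineK ?sqnorm_fin ?ell2_fun_summable//.
apply: le_trans (sqnorm_ge _ v).
case: (x v) => a b /=; rewrite sqr_sqrtr//.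
by rewrite addr_ge0 ?sqr_ge0.
Qed.

(** Pythagoras for the decomposition of ell^2(V1 + V2) into its two blocks; the norm estimates for
    restriction to [V2] and extension by zero follow from it. *)
Lemma sqnorm_sum (V1 V2 : choiceType) (f : V1 + V2 -> R[i]) :
  sqnorm f = (sqnorm (f \o inl) + sqnorm (f \o inr))%E.
Proof.
rewrite /sqnorm (esumID (range inl)); last by move=> v _; rewrite lee_fin sqr_ge0.
rewrite setTI (_ : _ `&` _ = range inr); last first.
  apply/seteqP; split => [[v|v]|_ [v _ <-]] /=.
  - by move=> [_ []]; exists v.
  - by move=> _; exists v.
  - by split=> // -[].
by rewrite !esum_image// => u v _ _ [].
Qed.

Lemma square_summable_inr (V1 V2 : choiceType) (x : ell2 R (V1 + V2)%type) :
  (fun v => x (inr v)) \in @square_summable R V2.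
Proof.
have := ell2_fun_summable x; rewrite !square_summableE sqnorm_sum.
by apply: le_lt_trans; rewrite leeDr// sqnorm_ge0.
Qed.

Definition ell2_inr (V1 V2 : choiceType) (x : ell2 R (V1 + V2)%type) : ell2 R V2 :=
  Ell2 (square_summable_inr x).

Definition extend_inr (V1 V2 : choiceType) (x : V2 -> R[i]) (v : V1 + V2) : R[i] :=
  if v is inr w then x w else 0.

Lemma sqnorm_extend_inr (V1 V2 : choiceType) (x : V2 -> R[i]) :
  sqnorm (@extend_inr V1 V2 x) = sqnorm x.
Proof.
rewrite sqnorm_sum [X in (X + _)%E]esum1 ?add0e// => v _.
by rewrite [(_ \o _) v]/(0 : R[i]) normc0 expr0n.
Qed.

Lemma square_summable_extend_inr (V1 V2 : choiceType) (x : ell2 R V2) :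
  extend_inr x \in @square_summable R (V1 + V2)%type.
Proof. by rewrite square_summableE sqnorm_extend_inr; exact: ell2_fun_summable. Qed.

Definition ell2_extend (V1 V2 : choiceType) (x : ell2 R V2) :
    ell2 R (V1 + V2)%type :=
  Ell2 (@square_summable_extend_inr V1 V2 x).

Lemma ell2_inr_linear (V1 V2 : choiceType) : linear (@ell2_inr V1 V2).
Proof. by move=> a x y; exact: ell2P. Qed.
HB.instance Definition _ V1 V2 :=
  GRing.isLinear.Build _ _ _ _ _ (@ell2_inr_linear V1 V2).

Lemma ell2_extend_linear (V1 V2 : choiceType) : linear (@ell2_extend V1 V2).
Proof.
by move=> a x y; apply: ell2P => -[v|v] //=; rewrite [RHS]addr0 [RHS]mulr0.
Qed.
HB.instance Definition _ V1 V2 :=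
  GRing.isLinear.Build _ _ _ _ _ (@ell2_extend_linear V1 V2).

Lemma ell2_norm_inr (V1 V2 : choiceType) (x : ell2 R (V1 + V2)%type) :
  `|ell2_inr x| <= `|x|.
Proof.
rewrite !ell2_normE lecR ler_wsqrtr// fine_le ?sqnorm_fin ?ell2_fun_summable//.
by rewrite [leRHS]sqnorm_sum leeDr// sqnorm_ge0.
Qed.

Lemma ell2_norm_extend (V1 V2 : choiceType) (x : ell2 R V2) :
  `|ell2_extend V1 x| = `|x|.
Proof. by rewrite !ell2_normE /l2norm sqnorm_extend_inr. Qed.

(** The codomain [R[i]^o] is the scalar field as a normed module over itself, so that evaluation is
    a linear map between normed modules. *)
Definition ell2_coord (V : choiceType) (v : V) (x : ell2 R V) : R[i]^o := x v.

Lemma ell2_coord_linear (V : choiceType) (v : V) : linear (ell2_coord v).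
Proof. by []. Qed.
HB.instance Definition _ V v :=
  GRing.isLinear.Build _ _ _ _ _ (@ell2_coord_linear V v).

Lemma ell2_coord_continuous (V : choiceType) (v : V) : continuous (ell2_coord v).
Proof.
apply: (@bound_linear_continuous _ _ _ (ell2_coord v) 1) => // x.
by rewrite mul1r ell2_norm_coord.
Qed.

Lemma ell2_inr_continuous (V1 V2 : choiceType) : continuous (@ell2_inr V1 V2).
Proof.
apply: (@bound_linear_continuous _ _ _ (@ell2_inr V1 V2) 1) => // x.
by rewrite mul1r ell2_norm_inr.
Qed.

Lemma ell2_extend_continuous (V1 V2 : choiceType) : continuous (@ell2_extend V1 V2).
Proof.
apply: (@bound_linear_continuous _ _ _ (@ell2_extend V1 V2) 1) => // x.
by rewrite mul1r ell2_norm_extend.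
Qed.

End Ell2Theory.

(** * The adjacency operator in coordinates *)

Section NeighbourSum.
Context (R : realType) (V : countType) (G : sgraph V).

(** The formal action of the adjacency matrix, finite by local finiteness; it is defined on plain
    functions so as to apply to [x \o inl] and [x \o inr]. *)
Definition neighbour_sum (x : V -> R[i]) (v : V) : R[i] :=
  \sum_(u \in [set u | G v u]) x u.

Lemma adjacency_basisE u v : adjacency_basis R G u v = (G u v)%:R.
Proof.
rewrite /adjacency_basis ell2_sumE; last exact: locally_finite.
have [uv|uv] := boolP (G u v).
  rewrite -(@fsbig_widen _ _ _ _ [set v] [set w | G u w])//= ?fsbig_set1 ?eqxx//.
    by move=> _ ->.
  by move=> w [_ /= /eqP/negPf wv]; rewrite eq_sym wv.
apply: fsbig1 => w /= uw; case: eqVneq uw => // <-.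
by rewrite (negPf uv).
Qed.

Lemma neighbour_sumE x v :
  neighbour_sum x v = \sum_(u \in [set: V]) x u * (G v u)%:R.
Proof.
rewrite /neighbour_sum -(@fsbig_widen _ _ _ _ [set u | G v u] setT)//=.
  by apply: eq_fsbigr => u /[!inE] /= ->; rewrite mulr1.
by move=> u [_ /= /negP/negPf ->]; rewrite mulr0.
Qed.

(** Symmetry of adjacency turns the column expansion of $\sum_u x_u A e_u$ at [v] into a sum over
    the neighbours of [v]. *)
Lemma finite_adjacencyP (x y : ell2 R V) :
  finite_adjacency R G (x, y) <->
  finite_set [set v | x v != 0] /\ forall v, y v = neighbour_sum x v.
Proof.
have E : finite_set [set v | x v != 0] -> forall v,
    (\sum_(u \in [set: V]) x u *: adjacency_basis R G u) v = neighbour_sum x v.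
  move=> xfin v; rewrite neighbour_sumE.
  rewrite -!(@fsbig_widen _ _ _ _ [set u | x u != 0] setT)//=; last 2 first.
  - by move=> u [_ /= /negP/negPn/eqP ->]; rewrite mul0r.
  - by move=> u [_ /= /negP/negPn/eqP ->]; rewrite scale0r.
  rewrite ell2_sumE//; apply: eq_fsbigr => u _ /=.
  by rewrite -[LHS]/(x u * adjacency_basis R G u v) adjacency_basisE adjacent_sym.
split=> [[x' + [xx']]|[xfin yE]].
  by rewrite xx' => xfin <-; split => //; exact: E.
by exists x => //; congr pair; apply: ell2P => v; rewrite E.
Qed.

End NeighbourSum.

(** * Neighbour sums across the bridge *)

Section CouplingSum.
Context (R : realType) (V1 V2 : countType) (G1 : sgraph V1) (G2 : sgraph V2).
Context (v1 : V1) (v2 : V2).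
Local Notation G := (coupling G1 G2 v1 v2).

Lemma neighbour_sum_inl (x : V1 + V2 -> R[i]) u :
  neighbour_sum G x (inl u) =
  neighbour_sum G1 (x \o inl) u + (u == v1)%:R * x (inr v2).
Proof.
(* The second set is the bridge: a singleton if [u] is [v1], empty otherwise. *)
rewrite /neighbour_sum (_ : [set w | G (inl u) w] =
   inl @` [set w | G1 u w] `|` [set w | w = inr v2 /\ u = v1]); last first.
  apply/seteqP; split=> [[w|w] /=|w /= [[t ut <-//]|[-> ->]]].
  - by left; exists w.
  - by move=> /andP[/eqP-> /eqP->]; right.
  - by rewrite /= !eqxx.
rewrite fsbigU0; last first.
- by move=> w [[t _ <-] []].
- by apply: sub_finite_set (finite_set1 (inr v2)) => w [].
- exact/finite_image/locally_finite.
rewrite fsbig_image; last by move=> ? ? _ _ [].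
congr (_ + _); have [->|uv1] := eqVneq u v1.
  rewrite mul1r (_ : [set _ | _] = [set inr v2]) ?fsbig_set1//.
  by apply/seteqP; split => [w []|w ->].
by rewrite mul0r fsbig1// => w [_ uv]; rewrite uv eqxx in uv1.
Qed.

Lemma neighbour_sum_inr (x : V1 + V2 -> R[i]) u :
  neighbour_sum G x (inr u) =
  neighbour_sum G2 (x \o inr) u + (u == v2)%:R * x (inl v1).
Proof.
rewrite /neighbour_sum (_ : [set w | G (inr u) w] =
   inr @` [set w | G2 u w] `|` [set w | w = inl v1 /\ u = v2]); last first.
  apply/seteqP; split=> [[w|w] /=|w /= [[t ut <-//]|[-> ->]]].
  - by move=> /andP[/eqP-> /eqP->]; right.
  - by left; exists w.
  - by rewrite /= !eqxx.
rewrite fsbigU0; last first.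
- by move=> w [[t _ <-] []].
- by apply: sub_finite_set (finite_set1 (inl v1)) => w [].
- exact/finite_image/locally_finite.
rewrite fsbig_image; last by move=> ? ? _ _ [].
congr (_ + _); have [->|uv1] := eqVneq u v2.
  rewrite mul1r (_ : [set _ | _] = [set inl v1]) ?fsbig_set1//.
  by apply/seteqP; split => [w []|w ->].
by rewrite mul0r fsbig1// => w [_ uv]; rewrite uv eqxx in uv1.
Qed.

End CouplingSum.

(** * The closed adjacency operator of the coupling *)

Section AdjacencyClosure.
Context (R : realType).

Lemma neighbour_sum_continuous (V : countType) (G : sgraph V) (v : V) :
  continuous (fun x : ell2 R V => neighbour_sum G x v : R[i]^o).
Proof.
rewrite (_ : (fun _ => _) = fun x : ell2 R V =>
    \sum_(u <- fset_set [set u | G v u]) ell2_coord u x); last first.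
  by apply/funext => x; rewrite /neighbour_sum fsbig_finite//; exact: locally_finite.
by apply: continuous_sumf => u; exact: ell2_coord_continuous.
Qed.

(** The difference of the two sides is continuous in [(x, y)] and vanishes on the finite operator.
    With unbounded degrees these equations need not characterize the closure, so
    [adjacency_coupling] keeps the closed operator of [G2]. *)
Lemma adjacency_neighbour_sum (V : countType) (G : sgraph V) (x y : ell2 R V) v :
  adjacency R G (x, y) -> y v = neighbour_sum G x v.
Proof.
pose f (p : ell2 R V * ell2 R V) : R[i]^o := p.2 v - neighbour_sum G p.1 v.
have cf : continuous f.
  apply: continuous_subf.
    exact: (continuous_compose (@continuous_snd _ _)
        (@ell2_coord_continuous R V v)).
  exact: (continuous_compose (@continuous_fst _ _)
        (@neighbour_sum_continuous V G v)).
have c0 : closed [set (0 : R[i]^o)].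
  apply: accessible_closed_set1; apply: hausdorff_accessible.
  exact: norm_hausdorff.
move=> /(closure_preimage cf c0) => /(_ _)/eqP; rewrite subr_eq0.
move=> /(_ _)/eqP; apply.
by move=> [a b] /finite_adjacencyP[_ ab]; rewrite /f /= ab subrr.
Qed.

Context (V1 : finType) (V2 : countType) (G1 : sgraph V1) (G2 : sgraph V2).
Context (v1 : V1) (v2 : V2).
Local Notation G := (coupling G1 G2 v1 v2).

(** The subtracted term is the contribution of the bridge at [v2]. Since [V1] is finite, taking the
    closure only matters on the [V2] block; continuous affine maps compare the two closures in both
    directions. *)
Lemma adjacency_coupling (x y : ell2 R (V1 + V2)%type) :
  adjacency R G (x, y) <->
  (forall u, y (inl u) = neighbour_sum G x (inl u)) /\
  adjacency R G2 (ell2_inr x, ell2_inr y - x (inl v1) *: ell2_basis R v2).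
Proof.
split=> [xy|[y1 y2]].
  split=> [u|]; first exact: adjacency_neighbour_sum.
  (* Restriction to [V2] with the bridge term removed; it sends the finite operator of the coupling
     into that of [G2]. *)
  pose f (p : ell2 R (V1 + V2)%type * ell2 R (V1 + V2)%type) :=
    (ell2_inr p.1, ell2_inr p.2 - p.1 (inl v1) *: ell2_basis R v2).
  have cf : continuous f.
    apply: continuous_pair.
      exact: (continuous_compose (@continuous_fst _ _)
        (@ell2_inr_continuous R V1 V2)).
    apply: continuous_subf.
      exact: (continuous_compose (@continuous_snd _ _)
        (@ell2_inr_continuous R V1 V2)).
    apply: continuous_scalef; last exact: cst_continuous.
    exact: (continuous_compose (@continuous_fst _ _)
        (@ell2_coord_continuous R _ (inl v1))).
  apply: (closure_preimage cf (@closed_closure _ _) _ xy) => -[a b].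
  move=> /finite_adjacencyP[afin ab]; apply: subset_closure; apply/finite_adjacencyP.
  split.
    by apply: (finite_preimage (f := inr)) afin => ? ? _ _ [].
  move=> v; rewrite /= -[LHS]/(b (inr v) - a (inl v1) * (v == v2)%:R) ab.
  by rewrite neighbour_sum_inr mulrC addrK.
set z := ell2_inr y - _ in y2.
(* [f] is continuous and affine, sends the graph of the finite operator of G2
   into that of the coupling, and hits (x, y) at (ell2_inr x, z). *)
pose f (p : ell2 R V2 * ell2 R V2) :=
  (x + ell2_extend V1 (p.1 - ell2_inr x),
   y + ell2_extend V1 (p.2 - z)
     + (p.1 v2 - x (inr v2)) *: ell2_basis R (inl v1 : V1 + V2)).
have cf : continuous f.
  apply: continuous_pair.
    apply: continuous_addf; first exact: cst_continuous.
    apply: continuous_compose (@ell2_extend_continuous R V1 V2).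
    by apply: continuous_subf; [exact: continuous_fst|exact: cst_continuous].
  apply: continuous_addf; last first.
    apply: continuous_scalef; last exact: cst_continuous.
    apply: continuous_subf; last exact: cst_continuous.
    exact: (continuous_compose (@continuous_fst _ _)
        (@ell2_coord_continuous R V2 v2)).
  apply: continuous_addf; first exact: cst_continuous.
  apply: continuous_compose (@ell2_extend_continuous R V1 V2).
  by apply: continuous_subf; [exact: continuous_snd|exact: cst_continuous].
have -> : (x, y) = f (ell2_inr x, z).
  by rewrite /f /= !subrr scale0r linear0 !addr0.
apply: (closure_preimage cf (@closed_closure _ _) _ y2) => -[a b].
move=> /finite_adjacencyP[afin ab]; rewrite /preimage /=.
have fl u : (f (a, b)).1 (inl u) = x (inl u) by rewrite -[LHS]/(_ + 0) addr0.
have fr u : (f (a, b)).1 (inr u) = a u.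
  by rewrite -[LHS]/(x (inr u) + (a u - x (inr u))) addrC subrK.
(* The basis vector in [f] compensates at [v1] for the replacement of [x (inr v2)] by [a v2] across
   the bridge. *)
have gl u : (f (a, b)).2 (inl u) = y (inl u) + (u == v1)%:R * (a v2 - x (inr v2)).
  rewrite -[LHS]/(y (inl u) + 0 + (a v2 - x (inr v2)) *
    (inl u == inl v1 :> V1 + V2)%:R).
  by rewrite addr0 mulrC.
have gr u : (f (a, b)).2 (inr u) = b u + (u == v2)%:R * x (inl v1).
  rewrite -[LHS]/(y (inr u) + (b u - (y (inr u) - x (inl v1) * (u == v2)%:R)) +
    (a v2 - x (inr v2)) * 0).
  by rewrite mulr0 addr0 opprB addrCA [y _ + _]addrC addrNK [x _ * _]mulrC.
case: (f (a, b)) fl fr gl gr => x' y' /= fl fr gl gr.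
apply: subset_closure; apply/finite_adjacencyP; split.
  (* The support lies in all of [V1], which is finite, together with the support of [a]. *)
  apply: (@sub_finite_set _ _ (range inl `|` inr @` [set v | a v != 0])).
    by move=> [u|u] /=; rewrite ?fr => ?; [left|right]; exists u.
  by rewrite finite_setU; split; apply: finite_image => //; exact: finite_finset.
move=> [u|u].
  rewrite gl y1 !neighbour_sum_inl fr (_ : x' \o inl = x \o inl).
    by rewrite mulrBr -addrA; congr (_ + _); rewrite addrC subrK.
  by apply/funext => w; exact: fl.
rewrite gr ab neighbour_sum_inr fl (_ : x' \o inr = a)//.
by apply/funext => w; exact: fr.
Qed.

End AdjacencyClosure.

(** * Determinants and finite linear systems *)

(** Rows and columns undergo the same permutation, so its sign occurs twice. The sizes are only
    propositionally equal because they will be cardinals of different types. *)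
Lemma det_mxsub_bij (K : comPzRingType) (n m : nat) (f : 'I_n -> 'I_m)
    (A : 'M[K]_m) :
  n = m -> injective f -> \det (mxsub f f A) = \det A.
Proof.
move=> nm; subst m => fI.
have -> : mxsub f f A = row_perm (perm fI) (col_perm (perm fI) A).
  by apply/matrixP => i j; rewrite !mxE !permE.
rewrite row_permE col_permE !det_mulmx mulrCA !det_perm odd_permV.
by rewrite -signr_addb addbb mulr1.
Qed.

Lemma sum_perturb (K : pzRingType) (I : finType) (r : I) (a b c : I -> K) (g : K) :
  (forall j, a j = b j - g * (j == r)%:R) ->
  \sum_j a j * c j = \sum_j b j * c j - g * c r.
Proof.
move=> ab; rewrite (bigD1 r)//= [in RHS](bigD1 r)//= ab eqxx mulr1 mulrBl addrAC.
congr (_ + _ - _); apply: eq_bigr => j /negPf jr.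
by rewrite ab jr mulr0 subr0.
Qed.

Section FiniteSolve.
Context (K : fieldType) (V : finType).
Implicit Types m : V -> V -> K.

(** Kernels on [V] are enumerated only to give access to determinants and inverses. *)
Definition finmx m : 'M[K]_#|V| := \matrix_(i, j) m (enum_val i) (enum_val j).

Lemma sum_enum_val (F : V -> K) : \sum_(j < #|V|) F (enum_val j) = \sum_w F w.
Proof. by rewrite -(big_enum_val (A := V) F); exact: eq_bigl. Qed.

(** The inverse matrix is read back as a kernel [n]; the first identity yields existence of
    solutions, the second uniqueness. *)
Lemma finmx_inverse m : \det (finmx m) != 0 ->
  exists n : V -> V -> K,
    (forall y u, \sum_w m u w * (\sum_t n w t * y t) = y u) /\
    (forall y u, \sum_w n u w * (\sum_t m w t * y t) = y u).
Proof.
rewrite -unitfE => mU.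
pose n u w := invmx (finmx m) (enum_rank u) (enum_rank w).
have E (a b : V -> V -> K) (y : V -> K) u :
    finmx a *m finmx b = 1%:M -> \sum_w a u w * (\sum_t b w t * y t) = y u.
  move=> ab; have -> : y u =
      (finmx a *m finmx b *m \col_j y (enum_val j)) (enum_rank u) 0.
    by rewrite ab mul1mx mxE enum_rankK.
  rewrite -mulmxA mxE -sum_enum_val.
  apply: eq_bigr => j _; rewrite !mxE enum_rankK; congr (_ * _).
  by rewrite -sum_enum_val; apply: eq_bigr => k _; rewrite !mxE.
have nE : finmx n = invmx (finmx m).
  by apply/matrixP => i j; rewrite mxE /n !enum_valK.
exists n; split=> y u; [apply: (E m n)|apply: (E n m)].
  by rewrite nE mulmxV// unitmxE.
by rewrite nE mulVmx// unitmxE.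
Qed.

Lemma finmx_kernel m : \det (finmx m) = 0 ->
  exists x : V -> K, (exists u, x u != 0) /\ forall u, \sum_w m u w * x w = 0.
Proof.
(* [det0P] yields a row vector in the left kernel, hence the transpose. *)
rewrite -det_tr => /eqP/det0P[x x0 xm].
exists (fun u => x 0 (enum_rank u)); split.
  by have /rV0Pn[j xj] := x0; exists (enum_val j); rewrite enum_valK.
move=> u; have /matrixP/(_ 0 (enum_rank u)) := xm; rewrite [RHS]mxE => xmu.
rewrite -[RHS]xmu mxE -sum_enum_val; apply: eq_bigr => j _.
by rewrite !mxE enum_rankK enum_valK mulrC.
Qed.

End FiniteSolve.

(** * The determinant of the Schur complement *)

Section CharacteristicExpansion.
Context (R : realType) (V : finType) (G : sgraph V) (v : V) (l : R[i]).

(** The principal minor at [v] and the matrix of the deleted graph list the same vertices, possibly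
    in different orders; the reindexing [g] preserves the determinant. *)
Lemma characteristic_delete :
  characteristic (delete_vertex G v) l =
  cofactor (l%:M - adjacency_mx R G) (enum_rank v) (enum_rank v).
Proof.
set r := enum_rank v.
have lP (w : {u : V | u != v}) : exists j, lift r j = enum_rank (val w).
  have : r != enum_rank (val w) by rewrite (inj_eq enum_rank_inj) eq_sym (valP w).
  by move=> /unlift_some[j jE _]; exists j.
have [g gE] := choice lP.
have gI : injective g.
  by move=> a b /(congr1 (lift r)); rewrite !gE => /enum_rank_inj/val_inj.
have cardE : #|{: {u : V | u != v}}| = #|V|.-1 by rewrite card_sig cardC1.
rewrite /cofactor -signr_odd addnn odd_double expr0 mul1r.
rewrite -(@det_mxsub_bij _ _ _ (fun i => g (enum_val i)) _ cardE); last first.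
  by move=> i j /gI/enum_val_inj.
rewrite /characteristic; congr (\det _); apply/matrixP => i j.
rewrite !mxE !gE !enum_rankK (inj_eq enum_rank_inj) (inj_eq val_inj).
by rewrite (inj_eq enum_val_inj).
Qed.

(** For [g] the Green's function of the second graph, this is the Schur complement left after
    eliminating [V2] from $l - A$. *)
Definition schur_coef (g : R[i]) (u w : V) : R[i] :=
  l * (u == w)%:R - (G u w)%:R - g * ((u == v) && (w == v))%:R.

(** Only the diagonal entry at [v] is perturbed, and the cofactors along that row do not see it; the
    coefficient of [g] is thus the diagonal cofactor. *)
Lemma det_schur (g : R[i]) :
  \det (finmx (schur_coef g)) =
  characteristic G l - g * characteristic (delete_vertex G v) l.
Proof.
rewrite characteristic_delete /characteristic.
set N := _%:M - _; set r := enum_rank v.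
have E i j : finmx (schur_coef g) i j = N i j - g * ((i == r) && (j == r))%:R.
  rewrite !mxE /schur_coef (inj_eq enum_val_inj) mulr_natr.
  by rewrite !(can2_eq (@enum_valK V) (@enum_rankK V)).
(* otherwise unification unfolds determinants through [N] and diverges *)
clearbody N.
have cE j : cofactor (finmx (schur_coef g)) r j = cofactor N r j.
  rewrite /cofactor; congr (_ * \det _); apply/matrixP => a b.
  do 2 rewrite [LHS]mxE [RHS]mxE.
  by rewrite E eq_sym (negPf (neq_lift _ _)) mulr0 subr0.
rewrite (expand_det_row (finmx (schur_coef g)) r) (expand_det_row N r).
transitivity (\sum_j finmx (schur_coef g) r j * cofactor N r j).
  by apply: eq_bigr => j _; rewrite cE.
by apply: sum_perturb => j; rewrite E eqxx.
Qed.

Lemma schur_coefE (g : R[i]) (x : V -> R[i]) u :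
  \sum_w schur_coef g u w * x w =
  l * x u - neighbour_sum G x u - g * ((u == v)%:R * x v).
Proof.
have s (a : V) (c : V -> R[i]) : \sum_w c w * (w == a)%:R * x w = c a * x a.
  rewrite (bigD1 a)//= eqxx mulr1 big1 ?addr0// => w /negPf ->.
  by rewrite mulr0 mul0r.
under eq_bigr do rewrite /schur_coef !mulrBl.
rewrite !sumrB; congr (_ - _ - _).
- by under eq_bigr do rewrite eq_sym; rewrite s.
- rewrite neighbour_sumE (fsbigE (index_enum V)) ?index_enum_uniq//.
    by rewrite [RHS]big_mkcond/=; apply: eq_bigr => w _; rewrite in_setT mulrC.
  by move=> w _; rewrite mem_index_enum.
- under eq_bigr do rewrite -mulnb natrM mulrA.
  by rewrite s mulrA.
Qed.

End CharacteristicExpansion.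

(** * Bounded inverses and the Green's function *)

Lemma shift_operatorP (K : numFieldType) (E : normedModType K) (T : set (E * E))
    (l : K) (x y : E) :
  shift_operator l T (x, y) <-> T (x, l *: x - y).
Proof.
split=> [[[a b] Tab /= [<- <-]]|Txy]; first by rewrite subKr.
by exists (x, l *: x - y) => //=; rewrite subKr.
Qed.

Lemma boundedly_invertible_inverse (K : numFieldType) (E : normedModType K)
    (T : set (E * E)) : boundedly_invertible T ->
  exists B : {linear E -> E}, continuous B /\ forall x y, T (x, y) <-> x = B y.
Proof.
move=> [B [[M BM] TB BT]]; exists B; split; last first.
  by move=> x y; split=> [/BT|->].
(* No sign is given for [M], but $M |z|$ dominates a norm, so [M] can be replaced by its absolute
   value. *)
apply: (@bound_linear_continuous _ _ _ B `|M|) => // z.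
have Mz : 0 <= M * `|z| by rewrite (le_trans _ (BM z)).
by rewrite -[X in _ * X]normr_id -normrM ger0_norm.
Qed.

Lemma continuous_boundedly_invertible (K : numFieldType) (E : normedModType K)
    (T : set (E * E)) (B : {linear E -> E}) :
  continuous B -> (forall x y, T (x, y) <-> x = B y) -> boundedly_invertible T.
Proof.
move=> /linear_bounded_continuous/linear_boundedP/pinfty_ex_gt0[M _ BM] TB.
exists B; split; first by exists M.
  by move=> z; apply/TB.
by move=> x z /TB ->.
Qed.

Lemma greenE (R : realType) (V : countType) (G : sgraph V) (l : R[i])
    (B : ell2 R V -> ell2 R V) v :
  (forall x y, shift_operator l (adjacency R G) (x, y) <-> x = B y) ->
  green G l v = B (ell2_basis R v) v.
Proof.
move=> TB; rewrite /green ell2_dot_basis /resolvent.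
(* The default case of [xget] is excluded: [B] supplies a preimage of the basis vector. *)
case: xgetP => [x _ /TB -> //|/(_ (B (ell2_basis R v)))].
by case; apply/TB.
Qed.

(** * Assembling a vector from its two blocks *)

Section Glue.
Context (R : realType) (V1 : finType) (V2 : countType).

(** Written as a finite combination of basis vectors plus an extension, so that square summability
    and continuity come from the normed module structure. *)
Definition ell2_glue (a : V1 -> R[i]) (p : ell2 R V2) : ell2 R (V1 + V2)%type :=
  \sum_(u : V1) a u *: ell2_basis R (inl u) + ell2_extend V1 p.

Lemma ell2_glue_inl a p u : ell2_glue a p (inl u) = a u.
Proof.
rewrite -[LHS]/((\sum_(u : V1) a u *: ell2_basis R (inl u : V1 + V2)) (inl u) + 0).
rewrite addr0 ell2_bigsumE (bigD1 u)//= big1 => [|w wu].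
  by rewrite addr0 -[LHS]/(a u * (inl u == inl u :> V1 + V2)%:R) eqxx mulr1.
by rewrite -[LHS]/(a w * (u == w)%:R) eq_sym (negPf wu) mulr0.
Qed.

Lemma ell2_glue_inr a p w : ell2_glue a p (inr w) = p w.
Proof.
rewrite -[LHS]/((\sum_(u : V1) a u *: ell2_basis R (inl u : V1 + V2)) (inr w) + p w).
by rewrite ell2_bigsumE big1 ?add0r// => u _; exact: mulr0.
Qed.

Lemma ell2_inr_glue a p : ell2_inr (ell2_glue a p) = p.
Proof. by apply: ell2P => w; exact: ell2_glue_inr. Qed.

End Glue.

(** * Block elimination and the resolvent of the coupling *)

Section CouplingResolvent.
Context (R : realType) (V1 : finType) (V2 : countType).
Context (G1 : sgraph V1) (G2 : sgraph V2) (v1 : V1) (v2 : V2) (l : R[i]).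
Local Notation G := (coupling G1 G2 v1 v2).
Local Notation H := (ell2 R (V1 + V2)%type).
Context (B2 : {linear ell2 R V2 -> ell2 R V2}).
Context (B2E : forall x y,
  shift_operator l (adjacency R G2) (x, y) <-> x = B2 y).
Local Notation g := (green G2 l v2).
Local Notation e2 := (ell2_basis R v2).

(** The [V2] block is solved by [B2]; inserting its value at [v2] into the [V1] equations produces
    the Green's function at [(v1, v1)]. *)
Lemma shift_couplingP (x y : H) :
  shift_operator l (adjacency R G) (x, y) <->
  (forall u, \sum_w schur_coef G1 v1 l g u w * x (inl w) =
     y (inl u) + (u == v1)%:R * B2 (ell2_inr y) v2) /\
  ell2_inr x = B2 (ell2_inr y) + x (inl v1) *: B2 e2.
Proof.
rewrite shift_operatorP adjacency_coupling.
have -> : ell2_inr (l *: x - y) - x (inl v1) *: e2 =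
    l *: ell2_inr x - (ell2_inr y + x (inl v1) *: e2).
  by rewrite linearB linearZ /= opprD addrA.
rewrite -shift_operatorP B2E linearD linearZ /=.
(* The two forms of the [V1] equations agree only modulo the [V2] equation, which eliminates
   [x (inr v2)]. *)
have E u : ell2_inr x = B2 (ell2_inr y) + x (inl v1) *: B2 e2 ->
    (l *: x - y) (inl u) = neighbour_sum G x (inl u) <->
    \sum_w schur_coef G1 v1 l g u w * x (inl w) =
     y (inl u) + (u == v1)%:R * B2 (ell2_inr y) v2.
  move=> /(congr1 (fun z : ell2 R V2 => z v2)) /=.
  rewrite -[X in _ = X -> _]/(B2 (ell2_inr y) v2 + x (inl v1) * B2 e2 v2).
  rewrite -(greenE v2 B2E) neighbour_sum_inl schur_coefE => ->.
  rewrite -[X in X = _ <-> _]/(l * x (inl u) - y (inl u)).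
  split=> [lxy|lxy].
    have -> : y (inl u) = l * x (inl u) - (l * x (inl u) - y (inl u)).
      by rewrite subKr.
    by rewrite lxy; ring.
  have -> : y (inl u) = y (inl u) + (u == v1)%:R * B2 (ell2_inr y) v2
    - (u == v1)%:R * B2 (ell2_inr y) v2 by rewrite addrK.
  by rewrite -lxy; ring.
split=> -[P Q]; split=> [u|]; try exact: Q.
  by apply/(E u Q); exact: P.
by apply/(E u Q); exact: P.
Qed.

(** A kernel vector [a] of the Schur complement extends by $a(v_1) B_2 e_{v_2}$ to an eigenvector of
    the coupling, which an inverse would have to be the image of 0. *)
Lemma coupling_singular :
  \det (finmx (schur_coef G1 v1 l g)) = 0 -> spectrum (adjacency R G) l.
Proof.
move=> /finmx_kernel[a [[u au] ak]] /boundedly_invertible_inverse[B [_ BE]].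
have x0 : ell2_glue a (a v1 *: B2 e2) = B 0.
  apply/BE/shift_couplingP; split=> [w|].
    rewrite !linear0 -[RHS]/(0 + (w == v1)%:R * 0) mulr0 addr0 -[RHS](ak w).
    by apply: eq_bigr => t _; rewrite ell2_glue_inl.
  by rewrite ell2_inr_glue ell2_glue_inl !linear0 add0r.
move: au; rewrite -(ell2_glue_inl a (a v1 *: B2 e2) u) x0 linear0.
by rewrite eqxx.
Qed.

Lemma coupling_regular : continuous B2 ->
  \det (finmx (schur_coef G1 v1 l g)) != 0 ->
  resolvent_set (adjacency R G) l.
Proof.
move=> cB2 /finmx_inverse[n [mn nm]].
(* Candidate inverse: [b] is $(B_2 y_2)(v_2)$, [c] solves the finite system with right-hand side
   $y_1 + b e_{v_1}$, and [Bf] glues in the resulting [V2] block. *)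
pose b (y : H) : R[i]^o := ell2_coord v2 (B2 (ell2_inr y)).
pose c u (y : H) : R[i]^o :=
  \sum_w n u w *: (ell2_coord (inl w) y + (w == v1)%:R *: b y).
pose Bf y := ell2_glue (c^~ y) (B2 (ell2_inr y) + c v1 y *: B2 e2).
have cB2inr : continuous (fun y : H => B2 (ell2_inr y)).
  exact: (continuous_compose (@ell2_inr_continuous R V1 V2) cB2).
have cb : continuous b.
  exact: (continuous_compose cB2inr (@ell2_coord_continuous R V2 v2)).
have cc u : continuous (c u).
  apply: continuous_sumf => w; apply: continuous_scalef; first exact: cst_continuous.
  apply: continuous_addf; first exact: ell2_coord_continuous.
  by apply: continuous_scalef; [exact: cst_continuous|exact: cb].
have cBf : continuous Bf.
  apply: continuous_addf.
    apply: continuous_sumf => u.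
    by apply: continuous_scalef; [exact: cc|exact: cst_continuous].
  apply: continuous_compose (@ell2_extend_continuous R V1 V2).
  apply: continuous_addf; first exact: cB2inr.
  by apply: continuous_scalef; [exact: cc|exact: cst_continuous].
have bL : linear b by move=> k x y; rewrite /b !linearP.
(* Linearity of one summand of [c], stated over scalars for [ring]. *)
have mulE (m k d s t s' t' : R[i]) :
    m * (k * s + t + d * (k * s' + t')) = k * (m * (s + d * s')) + m * (t + d * t').
  by ring.
have cL u : linear (c u).
  move=> k x y; rewrite /c scaler_sumr -big_split; apply: eq_bigr => w _ /=.
  by rewrite bL; exact: mulE.
have BfL : linear Bf.
  move=> k x y; apply: ell2P => -[u|u].
    rewrite -[RHS]/(k * Bf x (inl u) + Bf y (inl u)) !ell2_glue_inl.
    exact: cL.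
  rewrite -[RHS]/(k * Bf x (inr u) + Bf y (inr u)) !ell2_glue_inr.
  rewrite cL linearP linearP -[LHS]/(k * B2 (ell2_inr x) u + B2 (ell2_inr y) u +
    (k * c v1 x + c v1 y) * B2 e2 u).
  rewrite -[RHS]/(k * (B2 (ell2_inr x) u + c v1 x * B2 e2 u) +
    (B2 (ell2_inr y) u + c v1 y * B2 e2 u)).
  by ring.
pose BL : {linear H -> H} := HB.pack Bf (GRing.isLinear.Build _ _ _ _ Bf BfL).
apply: (@continuous_boundedly_invertible _ _ _ BL cBf) => x y.
(* The left inverse identity [nm] forces any solution to be [Bf y]; the right inverse identity [mn]
   shows that [Bf y] is one. *)
rewrite shift_couplingP; split=> [[xl xr]|->].
  have xc u : x (inl u) = c u y.
    rewrite -(nm (fun u => x (inl u)) u); apply: eq_bigr => w _.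
    by rewrite xl.
  apply: ell2P => -[u|u]; first by rewrite ell2_glue_inl.
  by rewrite ell2_glue_inr -xc -xr.
split=> [u|]; last by rewrite ell2_inr_glue ell2_glue_inl.
under eq_bigr do rewrite ell2_glue_inl.
by rewrite (mn (fun u => y (inl u) + (u == v1)%:R * b y)).
Qed.

End CouplingResolvent.

Theorem theorem1p1 (R : realType) (V1 : finType) (V2 : countType)
    (G1 : sgraph V1) (G2 : sgraph V2)
    (G1_connected : connected_graph G1) (G2_connected : connected_graph G2)
    (v1 : V1) (v2 : V2) (l : R[i]) :
  resolvent_set (adjacency R G2) l ->
  (spectrum (adjacency R (coupling G1 G2 v1 v2)) l <->
   characteristic G1 l - green G2 l v2 * characteristic (delete_vertex G1 v1) l
     = 0).
Proof.
move=> /boundedly_invertible_inverse[B2 [cB2 B2E]].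
(* The claim becomes that [l] is in the spectrum exactly when the Schur complement has determinant
   0; the forward direction is by contraposition. *)
rewrite -det_schur; split; last exact: coupling_singular B2E.
move=> sp; apply/eqP/negPn/negP => d0; apply: sp.
exact: coupling_regular B2E cB2 d0.
Qed.
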